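(* Let $B$ be a two-sided skew brace. If $B$ is i-noetherian and soluble, then $B$ is finitely generated (as a skew brace).
   Context: A skew brace is a set $B$ with two group operations $+$ and $\cdot$ (the latter written by juxtaposition; $+$ need not be commutative) such that $a(b+c)=ab-a+ac$ for all $a,b,c\in B$; both groups have the same identity, denoted $0$. It is two-sided if moreover $(b+c)a=ba-a+ca$ for all $a,b,c\in B$. For $a,b\in B$ put $\lambda_a(b)=-a+ab$. A subbrace of $B$ is a subset that is a subgroup of both $(B,+)$ and $(B,\cdot)$. An ideal is a subbrace $I$ with $(I,+)\unlhd(B,+)$, $(I,\cdot)\unlhd(B,\cdot)$ and $\lambda_a(I)\subseteq I$ for all $a\in B$; then $B/I$ is a skew brace. $B$ is finitely generated if there is a finite subset $X\subseteq B$ such that $B$ is the only subbrace of $B$ containing $X$. $B$ is i-noetherian if it satisfies the maximal condition (ascending chain condition) on ideals. A skew brace $A$ is abelian if $ab=ba=a+b=b+a$ for all $a,b\in A$. $B$ is soluble if there is a finite series of ideals of $B$, $0=I_0\leq I_1\leq\cdots\leq I_n=B$, such that $I_j/I_{j-1}$ is an abelian skew brace for every $1\le j\le n$. *)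

(* Defs.v *)
From HB Require Import structures.
From mathcomp Require Import all_boot.
From mathcomp Require Import boolp classical_sets cardinality.

Set Implicit Arguments.
Unset Strict Implicit.
Unset Printing Implicit Defensive.

Local Open Scope classical_set_scope.
Local Open Scope quotient_scope.
Local Open Scope group_scope.

(* The multiplicative group of a skew brace is its [groupType] structure; the
   additive group is new data, since MathComp's additive groups are commutative.
   No axiom equates the two identities: this follows, see [sb_one]. *)
HB.mixin Record isSkewBrace B of Group B := {
  sb_add : B -> B -> B;
  sb_zero : B;
  sb_opp : B -> B;
  sb_addA : forall a b c, sb_add a (sb_add b c) = sb_add (sb_add a b) c;
  sb_add0 : forall a, sb_add sb_zero a = a;
  sb_addN : forall a, sb_add (sb_opp a) a = sb_zero;
  sb_distl : forall a b c : B,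
    a * sb_add b c = sb_add (sb_add (a * b) (sb_opp a)) (a * c)
}.

#[short(type="skewBrace")]
HB.structure Definition SkewBrace := {B of isSkewBrace B & Group B}.

Declare Scope brace_scope.
Delimit Scope brace_scope with B.
Notation "0" := (@sb_zero _) : brace_scope.
Notation "a + b" := (sb_add a b) : brace_scope.
Notation "- a" := (sb_opp a) : brace_scope.
Notation "a - b" := (sb_add a (sb_opp b)) : brace_scope.
Local Open Scope brace_scope.

Definition two_sided (B : skewBrace) : Prop :=
  forall a b c : B, (b + c) * a = b * a - a + c * a.

Definition abelian_skew_brace (A : skewBrace) : Prop :=
  forall a b : A, [/\ a * b = b * a, b * a = a + b & a + b = b + a].

Definition lambda (B : skewBrace) (a b : B) : B := - a + a * b.

Definition add_subgroup (B : skewBrace) (S : set B) : Prop :=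
  [/\ S 0, forall x y, S x -> S y -> S (x + y) & forall x, S x -> S (- x)].

Definition mul_subgroup (B : skewBrace) (S : set B) : Prop :=
  [/\ S 1, forall x y, S x -> S y -> S (x * y) & forall x, S x -> S x^-1].

Definition is_subbrace (B : skewBrace) (S : set B) : Prop :=
  add_subgroup S /\ mul_subgroup S.

Definition is_ideal (B : skewBrace) (S : set B) : Prop :=
  [/\ is_subbrace S,
      forall a x, S x -> S (- a + x + a),
      forall a x, S x -> S (a^-1 * x * a) &
      forall a x, S x -> S (lambda a x)].

Record subbrace (B : skewBrace) := Subbrace {
  subbrace_set :> set B;
  subbraceP : is_subbrace subbrace_set
}.

Record ideal (B : skewBrace) := Ideal {
  ideal_set : set B;
  idealP : is_ideal ideal_set
}.

Lemma ideal_is_subbrace (B : skewBrace) (I : ideal B) :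
  is_subbrace (ideal_set I).
Proof. by case: (idealP I). Qed.

Coercion ideal_subbrace (B : skewBrace) (I : ideal B) : subbrace B :=
  Subbrace (ideal_is_subbrace I).

Section SkewBraceTheory.
Variable B : skewBrace.
Implicit Types a b c x y : B.

Lemma sb_addKl a b : - a + (a + b) = b.
Proof. by rewrite sb_addA sb_addN sb_add0. Qed.

Lemma sb_addrI a b c : a + b = a + c -> b = c.
Proof. by move=> e; rewrite -(sb_addKl a b) e sb_addKl. Qed.

Lemma sb_addr0 a : a + 0 = a.
Proof. by apply: (@sb_addrI (- a)); rewrite sb_addA sb_addN sb_add0. Qed.

Lemma sb_addrN a : a - a = 0.
Proof. by apply: (@sb_addrI (- a)); rewrite sb_addKl sb_addr0. Qed.

Lemma sb_addNKl a b : a + (- a + b) = b.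
Proof. by rewrite sb_addA sb_addrN sb_add0. Qed.

Lemma sb_oppK a : - - a = a.
Proof. by apply: (@sb_addrI (- a)); rewrite sb_addrN sb_addN. Qed.

Lemma sb_oppD a b : - (a + b) = - b - a.
Proof.
apply: (@sb_addrI (a + b)).
by rewrite sb_addrN -sb_addA sb_addNKl sb_addrN.
Qed.

Lemma sb_mulr0 a : a * 0 = a.
Proof.
have /esym := sb_distl a 0 0; rewrite sb_add0 -sb_addA -[RHS]sb_addr0.
by move/sb_addrI => e; apply: (@sb_addrI (- a)); rewrite e sb_addN.
Qed.

Lemma sb_one : 1 = 0 :> B.
Proof. by rewrite -[RHS]mul1g sb_mulr0. Qed.

Lemma lambdaM a b c : lambda (a * b) c = lambda a (lambda b c).
Proof.
have aN x : a * - x = a - a * x + a.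
  apply: (@sb_addrI (- a)); apply: (@sb_addrI (a * x)).
  rewrite [LHS]sb_addA -sb_distl sb_addrN sb_mulr0.
  by rewrite -(sb_addA a) sb_addKl sb_addNKl.
by rewrite /lambda sb_distl aN -!mulgA -!sb_addA !sb_addNKl sb_addKl.
Qed.

Lemma lambda1 c : lambda 1 c = c.
Proof.
by rewrite /lambda mul1g sb_one; have := sb_addKl 0 c; rewrite sb_add0.
Qed.

Lemma lambdaK a c : lambda a^-1 (lambda a c) = c.
Proof. by rewrite -lambdaM mulVg lambda1. Qed.


End SkewBraceTheory.

Section SubBrace.
Variables (B : skewBrace) (S : subbrace B).

Definition sub_brace : Type := {x : B | x \in (S : set B)}.
HB.instance Definition _ := SubChoice.on sub_brace.
Implicit Types x y z : sub_brace.

Lemma sub_braceP x : (S : set B) (\val x).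
Proof. exact: set_mem (valP x). Qed.

Definition sub_mk a (Sa : (S : set B) a) : sub_brace := Sub a (mem_set Sa).

Fact sub_zero_subproof : (S : set B) 0.
Proof. by case: (subbraceP S) => -[]. Qed.
Fact sub_add_subproof x y : (S : set B) (\val x + \val y).
Proof. by case: (subbraceP S) => -[_ SD _] _; apply: SD; apply: sub_braceP. Qed.
Fact sub_opp_subproof x : (S : set B) (- \val x).
Proof. by case: (subbraceP S) => -[_ _ SN] _; apply: SN; apply: sub_braceP. Qed.
Fact sub_one_subproof : (S : set B) 1.
Proof. by case: (subbraceP S) => _ []. Qed.
Fact sub_mul_subproof x y : (S : set B) (\val x * \val y).
Proof. by case: (subbraceP S) => _ [_ SM _]; apply: SM; apply: sub_braceP. Qed.
Fact sub_inv_subproof x : (S : set B) (\val x)^-1.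
Proof. by case: (subbraceP S) => _ [_ _ SV]; apply: SV; apply: sub_braceP. Qed.

Definition sub_zero := sub_mk sub_zero_subproof.
Definition sub_add x y := sub_mk (sub_add_subproof x y).
Definition sub_opp x := sub_mk (sub_opp_subproof x).
Definition sub_one := sub_mk sub_one_subproof.
Definition sub_mul x y := sub_mk (sub_mul_subproof x y).
Definition sub_inv x := sub_mk (sub_inv_subproof x).

Fact sub_mulA : associative sub_mul.
Proof. by move=> x y z; apply: val_inj; rewrite !SubK mulgA. Qed.
Fact sub_mul1 : left_id sub_one sub_mul.
Proof. by move=> x; apply: val_inj; rewrite !SubK mul1g. Qed.
Fact sub_mulr1 : right_id sub_one sub_mul.
Proof. by move=> x; apply: val_inj; rewrite !SubK mulg1. Qed.
Fact sub_mulV : left_inverse sub_one sub_inv sub_mul.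
Proof. by move=> x; apply: val_inj; rewrite !SubK mulVg. Qed.
Fact sub_mulrV : right_inverse sub_one sub_inv sub_mul.
Proof. by move=> x; apply: val_inj; rewrite !SubK mulgV. Qed.

HB.instance Definition _ := isGroup.Build sub_brace
  sub_mulA sub_mul1 sub_mulr1 sub_mulV sub_mulrV.

Fact sub_addA x y z : sub_add x (sub_add y z) = sub_add (sub_add x y) z.
Proof. by apply: val_inj; rewrite !SubK sb_addA. Qed.
Fact sub_add0 x : sub_add sub_zero x = x.
Proof. by apply: val_inj; rewrite !SubK sb_add0. Qed.
Fact sub_addN x : sub_add (sub_opp x) x = sub_zero.
Proof. by apply: val_inj; rewrite !SubK sb_addN. Qed.
Fact sub_distl x y z :
  x * sub_add y z = sub_add (sub_add (x * y) (sub_opp x)) (x * z).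
Proof. by apply: val_inj; rewrite !SubK sb_distl. Qed.

HB.instance Definition _ := isSkewBrace.Build sub_brace
  sub_addA sub_add0 sub_addN sub_distl.

End SubBrace.

Section Quotient.
Variables (B : skewBrace) (I : ideal B).
Implicit Types x y z : B.

Fact ideal_0 : (I : set B) 0. Proof. by case: (idealP I) => -[[]]. Qed.
Fact ideal_D x y : (I : set B) x -> (I : set B) y -> (I : set B) (x + y).
Proof. by case: (idealP I) => -[[_ h _] _ _ _ _]; apply: h. Qed.
Fact ideal_N x : (I : set B) x -> (I : set B) (- x).
Proof. by case: (idealP I) => -[[_ _ h] _ _ _ _]; apply: h. Qed.
Fact ideal_M x y : (I : set B) x -> (I : set B) y -> (I : set B) (x * y).
Proof. by case: (idealP I) => -[_ [_ h _] _ _ _]; apply: h. Qed.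
Fact ideal_V x : (I : set B) x -> (I : set B) x^-1.
Proof. by case: (idealP I) => -[_ [_ _ h] _ _ _]; apply: h. Qed.
Fact ideal_addJ a x : (I : set B) x -> (I : set B) (- a + x + a).
Proof. by case: (idealP I) => _ h _ _; apply: h. Qed.
Fact ideal_mulJ a x : (I : set B) x -> (I : set B) (a^-1 * x * a).
Proof. by case: (idealP I) => _ _ h _; apply: h. Qed.
Fact ideal_lambda a x : (I : set B) x -> (I : set B) (lambda a x).
Proof. by case: (idealP I) => _ _ _; apply. Qed.

(* x and y lie in the same additive coset of I; by [quot_relM] additive and
   multiplicative cosets of an ideal coincide. *)
Definition quot_rel x y : bool := `[< (I : set B) (- x + y) >].

Fact quot_rel_refl : reflexive quot_rel.
Proof. by move=> x; apply/asboolP; rewrite sb_addN; exact: ideal_0. Qed.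

Fact quot_relS x y : quot_rel x y -> quot_rel y x.
Proof.
by move=> /asboolP/ideal_N; rewrite sb_oppD sb_oppK => ?; apply/asboolP.
Qed.

Fact quot_rel_sym : symmetric quot_rel.
Proof. by move=> x y; apply/idP/idP; apply: quot_relS. Qed.

Fact quot_rel_trans : transitive quot_rel.
Proof.
move=> y x z /asboolP xy /asboolP yz; apply/asboolP.
by have := ideal_D xy yz; rewrite -sb_addA sb_addNKl.
Qed.

Canonical quot_equiv :=
  EquivRel quot_rel quot_rel_refl quot_rel_sym quot_rel_trans.

Lemma quot_relM x y : quot_rel x y <-> (I : set B) (x^-1 * y).
Proof.
have e : - x + y = lambda x (x^-1 * y) by rewrite /lambda mulVKg.
split=> [/asboolP|h]; last by apply/asboolP; rewrite e; apply: ideal_lambda.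
by rewrite e => /(ideal_lambda x^-1); rewrite lambdaK.
Qed.

Definition quot_brace : Type := {eq_quot quot_equiv}.
HB.instance Definition _ := Choice.on quot_brace.
HB.instance Definition _ := EqQuotient.on quot_brace.
Implicit Types p q r : quot_brace.

Definition quot_pi x : quot_brace := \pi_({eq_quot quot_equiv}) x.

Lemma quot_piP x y : quot_pi x = quot_pi y <-> (I : set B) (- x + y).
Proof.
split=> [/eqmodP/asboolP//|h]; by apply/eqmodP/asboolP.
Qed.

Lemma quot_piMP x y : quot_pi x = quot_pi y <-> (I : set B) (x^-1 * y).
Proof.
by split=> [/eqmodP/quot_relM//|h]; apply/eqmodP/quot_relM.
Qed.

Lemma quot_piW (P : quot_brace -> Prop) :
  (forall x, P (quot_pi x)) -> forall p, P p.
Proof. by move=> h p; rewrite -[p]reprK; apply: h. Qed.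

Definition quot_zero := quot_pi 0.
Definition quot_add p q := quot_pi (repr p + repr q).
Definition quot_opp p := quot_pi (- repr p).
Definition quot_one := quot_pi 1.
Definition quot_mul p q := quot_pi (repr p * repr q).
Definition quot_inv p := quot_pi (repr p)^-1.

Fact repr_pi x : (I : set B) (- x + repr (quot_pi x)).
Proof. by apply/quot_piP; rewrite /quot_pi reprK. Qed.
Fact repr_piM x : (I : set B) (x^-1 * repr (quot_pi x)).
Proof. by apply/quot_piMP; rewrite /quot_pi reprK. Qed.

Lemma quot_addE x y : quot_add (quot_pi x) (quot_pi y) = quot_pi (x + y).
Proof.
apply/esym/quot_piP; set x' := repr _; set y' := repr _.
have := ideal_D (ideal_addJ y (repr_pi x)) (repr_pi y).
by rewrite -!sb_addA sb_addNKl sb_oppD -!sb_addA.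
Qed.

Lemma quot_oppE x : quot_opp (quot_pi x) = quot_pi (- x).
Proof.
apply/quot_piP; rewrite sb_oppK.
have := ideal_addJ (- x) (repr_pi x).
by rewrite sb_oppK -!sb_addA sb_addNKl.
Qed.

Lemma quot_mulE x y : quot_mul (quot_pi x) (quot_pi y) = quot_pi (x * y).
Proof.
apply/esym/quot_piMP; have := ideal_M (ideal_mulJ y (repr_piM x)) (repr_piM y).
by rewrite -!mulgA mulVKg invgM -!mulgA.
Qed.

Lemma quot_invE x : quot_inv (quot_pi x) = quot_pi x^-1.
Proof.
apply/quot_piMP; rewrite invgK.
have := ideal_mulJ x^-1 (repr_piM x).
by rewrite invgK -!mulgA mulVKg.
Qed.

Fact quot_mulA : associative quot_mul.
Proof.
elim/quot_piW=> x; elim/quot_piW=> y; elim/quot_piW=> z.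
by rewrite !quot_mulE mulgA.
Qed.
Fact quot_mul1 : left_id quot_one quot_mul.
Proof. by elim/quot_piW=> x; rewrite quot_mulE mul1g. Qed.
Fact quot_mulr1 : right_id quot_one quot_mul.
Proof. by elim/quot_piW=> x; rewrite quot_mulE mulg1. Qed.
Fact quot_mulV : left_inverse quot_one quot_inv quot_mul.
Proof. by elim/quot_piW=> x; rewrite quot_invE quot_mulE mulVg. Qed.
Fact quot_mulrV : right_inverse quot_one quot_inv quot_mul.
Proof. by elim/quot_piW=> x; rewrite quot_invE quot_mulE mulgV. Qed.

HB.instance Definition _ := isGroup.Build quot_brace
  quot_mulA quot_mul1 quot_mulr1 quot_mulV quot_mulrV.

Fact quot_addA p q r : quot_add p (quot_add q r) = quot_add (quot_add p q) r.
Proof.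
by elim/quot_piW: p => x; elim/quot_piW: q => y; elim/quot_piW: r => z;
   rewrite !quot_addE sb_addA.
Qed.
Fact quot_add0 p : quot_add quot_zero p = p.
Proof. by elim/quot_piW: p => x; rewrite quot_addE sb_add0. Qed.
Fact quot_addN p : quot_add (quot_opp p) p = quot_zero.
Proof. by elim/quot_piW: p => x; rewrite quot_oppE quot_addE sb_addN. Qed.
Fact quot_distl p q r :
  p * quot_add q r = quot_add (quot_add (p * q) (quot_opp p)) (p * r).
Proof.
elim/quot_piW: p => x; elim/quot_piW: q => y; elim/quot_piW: r => z.
rewrite -[_ * quot_add _ _]/(quot_mul _ _) -[_ * quot_pi y]/(quot_mul _ _).
rewrite -[_ * quot_pi z]/(quot_mul _ _).
by rewrite !(quot_oppE, quot_addE, quot_mulE) sb_distl.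
Qed.

HB.instance Definition _ := isSkewBrace.Build quot_brace
  quot_addA quot_add0 quot_addN quot_distl.

End Quotient.

Section Factor.
Variables (B : skewBrace) (S : subbrace B) (I : ideal B).

(* The ideal S `&` I of the skew brace S; this is I itself when I `<=` S. *)
Definition restrict_set : set (sub_brace S) := [set x | (I : set B) (\val x)].

Fact restrict_is_ideal : is_ideal restrict_set.
Proof.
case: (idealP I) => -[[I0 ID IN] [I1 IM IV]] IJ IK IL.
split; [split; split|..] => //=.
- by move=> x y; apply: ID.
- by move=> x; apply: IN.
- by move=> x y; apply: IM.
- by move=> x; apply: IV.
- by move=> a x; apply: IJ.
- by move=> a x; apply: IK.
- by move=> a x; apply: IL.
Qed.

Definition restrict : ideal (sub_brace S) := Ideal restrict_is_ideal.

Definition factor_brace : skewBrace := quot_brace restrict.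

End Factor.

Arguments factor_brace {B} S I.

Definition i_noetherian (B : skewBrace) : Prop :=
  forall I : nat -> ideal B,
    (forall n, (I n : set B) `<=` I n.+1) ->
    exists N, forall n, (N <= n)%N -> (I n : set B) = I N.

Definition soluble (B : skewBrace) : Prop :=
  exists (n : nat) (I : nat -> ideal B),
    [/\ (I 0%N : set B) = [set 0],
        (I n : set B) = setT &
        forall j, (j < n)%N ->
          (I j : set B) `<=` I j.+1 /\
          abelian_skew_brace (factor_brace (I j.+1) (I j))].

Definition finitely_generated (B : skewBrace) : Prop :=
  exists2 X : set B, finite_set X &
    forall S : subbrace B, X `<=` S -> (S : set B) = setT.

(* Main.v *)
Require Import Defs.
From mathcomp Require Import all_boot.
From mathcomp Require Import boolp classical_sets cardinality.

(** Go down the soluble series [I], showing that some finite set together with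
    [I j] generates [B].  For the step from [j.+1] to [j], let a subbrace [T]
    contain [I j], generators of [B] modulo [I j.+1], and a finite set that
    generates [I j.+1] as an ideal (it exists because [B] is i-noetherian).
    Then [B = T + I j.+1]; the set [T `&` I j.+1] is stable under the operations
    of [T], and also under those of [I j.+1], which act trivially modulo
    [I j].  So it is an ideal, hence contains [I j.+1], and [T = B]. *)

Set Implicit Arguments.
Unset Strict Implicit.
Unset Printing Implicit Defensive.

Local Open Scope classical_set_scope.
Local Open Scope group_scope.
Local Open Scope brace_scope.

Section GeneratedIdeal.
Variable B : skewBrace.

Definition ideal_gen_set (Y : set B) : set B :=
  [set x | forall I : ideal B, Y `<=` (I : set B) -> (I : set B) x].

Lemma ideal_gen_is_ideal (Y : set B) : is_ideal (ideal_gen_set Y).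
Proof.
split; [split; split|..].
- by move=> I _; exact: ideal_0.
- by move=> x y hx hy I hI; apply: ideal_D; [apply: hx|apply: hy].
- by move=> x hx I hI; apply: ideal_N; apply: hx.
- by move=> I _; rewrite sb_one; exact: ideal_0.
- by move=> x y hx hy I hI; apply: ideal_M; [apply: hx|apply: hy].
- by move=> x hx I hI; apply: ideal_V; apply: hx.
- by move=> a x hx I hI; apply: ideal_addJ; apply: hx.
- by move=> a x hx I hI; apply: ideal_mulJ; apply: hx.
- by move=> a x hx I hI; apply: ideal_lambda; apply: hx.
Qed.

Definition ideal_gen (Y : set B) : ideal B := Ideal (ideal_gen_is_ideal Y).

(** Otherwise each finite subset of [A] could be enlarged by an element of [A] outside the ideal it
    generates, and iterating from [set0] would give a strictly ascending chain of ideals. *)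
Lemma i_noetherian_ideal_fg (A : ideal B) : i_noetherian B ->
  exists Y : set B, [/\ finite_set Y, Y `<=` (A : set B) &
    forall K : ideal B, Y `<=` (K : set B) -> (A : set B) `<=` (K : set B)].
Proof.
move=> noeth; apply: contrapT => nfg.
have /choice [f fP] : forall Y : set B, exists a,
    finite_set Y -> Y `<=` (A : set B) ->
    (A : set B) a /\ ~ (ideal_gen Y : set B) a.
  move=> Y; apply: contrapT => nex; apply: nfg; exists Y.
  (* If [Y] is infinite or not inside [A], the implication is vacuous and the dummy witness [0]
     contradicts [nex]. *)
  have Yfin : finite_set Y.
    by apply: contrapT => nfin; apply: nex; exists 0 => /nfin.
  have YA : Y `<=` (A : set B).
    by apply: contrapT => nYA; apply: nex; exists 0 => _ /nYA.
  split=> // K YK a Aa; apply: contrapT => nKa.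
  by apply: nex; exists a => _ _; split=> // /(_ K YK).
pose Y n := iter n (fun Z => Z `|` [set f Z]) set0.
have YP n : finite_set (Y n) /\ Y n `<=` (A : set B).
  elim: n => [|n [fin sub]]; first by split; [exact: finite_set0|].
  split; first by rewrite /= finite_setU; split=> //; exact: finite_set1.
  by move=> _ [/sub //|->]; case: (fP _ fin sub).
have [|N stab] := noeth (fun n => ideal_gen (Y n)).
  by move=> n x hx I hI; apply: hx => y hy; apply: hI; left.
(* The element [f (Y N)] was adjoined at stage [N.+1], where the generated ideal no longer grows. *)
case: (YP N) => fin sub; case: (fP _ fin sub) => _; apply.
rewrite -(stab N.+1 (leqnSn N)) => I; apply.
by right.
Qed.

End GeneratedIdeal.

Section AddIdeal.
Variables (B : skewBrace) (T : subbrace B) (A : ideal B).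

(** This is [T + A], encoded as the preimage of the image of [T] in [B/A], so that closure follows
    from the compatibility of [quot_pi] with the operations. *)
Definition subbrace_add_set : set B :=
  [set b | exists2 t, (T : set B) t & quot_pi A t = quot_pi A b].

Lemma subbrace_add_is_subbrace : is_subbrace subbrace_add_set.
Proof.
case: (subbraceP T) => -[T0 TD TN] [T1 TM TV].
split; split; [by exists 0| | |by exists 1| |].
- move=> b c [x Tx ex] [y Ty ey]; exists (x + y); first exact: TD.
  by rewrite -!quot_addE ex ey.
- move=> b [x Tx ex]; exists (- x); first exact: TN.
  by rewrite -!quot_oppE ex.
- move=> b c [x Tx ex] [y Ty ey]; exists (x * y); first exact: TM.
  by rewrite -!quot_mulE ex ey.
- move=> b [x Tx ex]; exists x^-1; first exact: TV.
  by rewrite -!quot_invE ex.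
Qed.

Definition subbrace_add : subbrace B := Subbrace subbrace_add_is_subbrace.

End AddIdeal.

Section AbelianFactor.
Variables (B : skewBrace) (A J : ideal B).
Hypothesis abAJ : abelian_skew_brace (factor_brace A J).

(** In [A/J] the two operations coincide and commute, so both conjugations and [lambda] fix the
    class of [x]. *)
Lemma abelian_factorP a x : (A : set B) a -> (A : set B) x ->
  [/\ (J : set B) (- x + (- a + x + a)), (J : set B) (x^-1 * (a^-1 * x * a)) &
      (J : set B) (- x + lambda a x)].
Proof.
move=> Aa Ax.
pose u : sub_brace A := sub_mk Aa; pose v : sub_brace A := sub_mk Ax.
pose p w : factor_brace A J := quot_pi (restrict A J) w.
have piD w z : p (w + z) = p w + p z by rewrite /p -quot_addE.
have piM w z : p (w * z) = p w * p z by rewrite /p -quot_mulE.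
have [e1 e2 e3] := abAJ (p u) (p v).
split.
- suff /quot_piP : p v = p (- u + v + u) by [].
  by rewrite -sb_addA piD piD -e3 -!piD sb_addKl.
- suff /quot_piMP : p v = p (u^-1 * v * u) by [].
  by rewrite -mulgA piM piM -e1 -!piM mulKg.
- suff /quot_piP : p v = p (lambda u v) by [].
  by rewrite /lambda piD piM e1 e2 -!piD sb_addKl.
Qed.

Lemma subbrace_cap_is_ideal (T : subbrace B) :
  (J : set B) `<=` (A : set B) -> (J : set B) `<=` (T : set B) ->
  (subbrace_add T A : set B) = setT ->
  is_ideal ((T : set B) `&` (A : set B)).
Proof.
move=> JA JT TA.
case: (subbraceP T) => -[T0 TD TN] [T1 TM TV].
have decomp b : exists2 t, (T : set B) t & quot_pi A t = quot_pi A b.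
  by have : (subbrace_add T A : set B) b by rewrite TA.
split; [split; split|..].
- by split=> //; exact: ideal_0.
- by move=> x y [? ?] [? ?]; split; [exact: TD|exact: ideal_D].
- by move=> x [? ?]; split; [exact: TN|exact: ideal_N].
- by split=> //; rewrite sb_one; exact: ideal_0.
- by move=> x y [? ?] [? ?]; split; [exact: TM|exact: ideal_M].
- by move=> x [? ?]; split; [exact: TV|exact: ideal_V].
(* Conjugate by [t] first, staying in [T], and then by [- t + b], which lies in [A] and changes the
   result only by an element of [J]. *)
- move=> b x [Tx Ax]; split; last exact: ideal_addJ.
  have [t Tt /quot_piP Aa] := decomp b.
  have [/JT Ty _ _] := abelian_factorP Aa (ideal_addJ t Ax).
  have Tz : (T : set B) (- t + x + t) by do !apply: (TD) => //; exact: TN.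
  have := TD _ _ Tz Ty.
  by rewrite sb_addNKl sb_oppD sb_oppK -!sb_addA !sb_addNKl.
- move=> b x [Tx Ax]; split; last exact: ideal_mulJ.
  have [t Tt /quot_piMP Aa] := decomp b.
  have [_ /JT Ty _] := abelian_factorP Aa (ideal_mulJ t Ax).
  have Tz : (T : set B) (t^-1 * x * t) by do !apply: (TM) => //; exact: TV.
  have := TM _ _ Tz Ty.
  by rewrite mulVKg invgM invgK -!mulgA !mulVKg.
(* Here the factor [t^-1 * b] from [A] acts first and [t] second, because [lambda] is a left
   action. *)
- move=> b x [Tx Ax]; split; last exact: ideal_lambda.
  have [t Tt /quot_piMP Aa] := decomp b.
  have [_ _ /JT Ty] := abelian_factorP Aa Ax.
  have := TD _ _ Tx Ty; rewrite sb_addNKl => Tl.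
  have -> : b = t * (t^-1 * b) by rewrite mulVKg.
  by rewrite lambdaM; apply: TD; [exact: TN|exact: TM].
Qed.

End AbelianFactor.

Theorem theorem3p4 (B : skewBrace) :
  two_sided B -> i_noetherian B -> soluble B -> finitely_generated B.
Proof.
move=> _ noeth [n [I [I0 In step]]].
(* The index [n - k] makes the induction descend from [I n], the whole of [B], to [I 0], which lies
   in every subbrace. *)
suff gen_mod k : (k <= n)%N -> exists2 X : set B, finite_set X &
    forall T : subbrace B, X `<=` (T : set B) ->
      (I (n - k)%N : set B) `<=` (T : set B) -> (T : set B) = setT.
  have [X Xfin XP] := gen_mod n (leqnn n); exists X => // T XT.
  apply: XP => //; rewrite subnn I0 => _ ->.
  by case: (subbraceP T) => -[].
elim: k => [_|k IHk kn].
  exists set0 => // T _; rewrite subn0 In => sub.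
  by apply/seteqP; split=> // x _; apply: sub.
have [X Xfin XP] := IHk (ltnW kn).
set j := (n - k.+1)%N.
have ej : (n - k)%N = j.+1 by rewrite /j -subSn.
have jn : (j < n)%N by rewrite -ej leq_subr.
rewrite ej in XP; have [JA abAJ] := step j jn.
have [Y [Yfin YA YP]] := i_noetherian_ideal_fg (I j.+1) noeth.
exists (X `|` Y); first by rewrite finite_setU.
move=> T XYT JT.
(* First use of [XP]: the sum contains [X] through [T], and [I j.+1] as the class of [0]. *)
have TA : (subbrace_add T (I j.+1) : set B) = setT.
  apply: XP => [x Xx|a Aa]; first by exists x => //; apply: XYT; left.
  exists 0; first by case: (subbraceP T) => -[].
  apply/quot_piP; apply: ideal_D Aa; apply: ideal_N; exact: ideal_0.
pose K := Ideal (subbrace_cap_is_ideal abAJ JA JT TA).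
(* Second use of [XP], now for [T] itself: the ideal [K] contains [Y], hence all of [I j.+1]. *)
apply: XP => [x Xx|]; first by apply: XYT; left.
have AK : (I j.+1 : set B) `<=` (K : set B).
  by apply: YP => y Yy; split; [apply: XYT; right|exact: YA].
by move=> a /AK[].
Qed.
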